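(* Let $T:\mathbb{R}^n\to \mathcal{P}(\mathbb{R}^n)$ be a multivalued map that is maximal $h$-monotone, and let $Z\subset\mathbb{R}^n$ be a set of Lebesgue measure zero such that $T$ is single valued in $\mathbb{R}^n\setminus Z$. Then the class $$\Sigma=\{E\subset \mathbb{R}^n: T(E)\text{ is Lebesgue measurable}\}$$ is a $\sigma$-algebra, and the set function $$\mu(E)=|T(E)|$$ is $\sigma$-additive on $\Sigma$; that is, $(\mathbb{R}^n,\Sigma,\mu)$ is a measure space.
   Context: Standing assumptions on the cost: $h\in C^2(\mathbb{R}^n)$ is real-valued, nonnegative, and positively homogeneous of degree $p$ for some real $p\ge 2$ (i.e. $h(tx)=t^p h(x)$ for $t>0$), and its Hessian $D^2h(x)$ is positive definite for each $x$ in the unit sphere $S^{n-1}$; equivalently there are constants $\lambda,\Lambda>0$ such that $\lambda|v|^2\le \langle D^2h(x)v,v\rangle\le \Lambda|v|^2$ for all $x\in S^{n-1}$, $v\in\mathbb{R}^n$. $\mathcal{P}(\mathbb{R}^n)$ is the set of all subsets of $\mathbb{R}^n$. The domain of $T$ is $\mathrm{dom}(T)=\{x\in\mathbb{R}^n: T(x)\neq\emptyset\}$. The map $T$ is $h$-monotone if $$h(x-\xi)+h(y-\zeta)\le h(x-\zeta)+h(y-\xi)$$ for all $x,y\in\mathrm{dom}(T)$, all $\xi\in T(x)$ and all $\zeta\in T(y)$. An $h$-monotone map $T$ is maximal $h$-monotone if whenever $T':\mathbb{R}^n\to\mathcal{P}(\mathbb{R}^n)$ is $h$-monotone and $T(x)\subset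 T'(x)$ for all $x\in\mathbb{R}^n$, then $T'=T$. ''$T$ is single valued in $\mathbb{R}^n\setminus Z$'' means that $T(x)$ consists of exactly one point for each $x\in\mathbb{R}^n\setminus Z$. For $E\subset\mathbb{R}^n$, $T(E)=\bigcup_{x\in E}T(x)$, and $|\cdot|$ denotes Lebesgue measure on $\mathbb{R}^n$. *)

(* Defs.v *)
From HB Require Import structures.
From mathcomp Require Import all_boot all_order all_algebra.
From mathcomp Require Import all_classical all_reals all_analysis.

Set Implicit Arguments.
Unset Strict Implicit.
Unset Printing Implicit Defensive.
Import Order.TTheory GRing.Theory Num.Theory.
Import numFieldNormedType.Exports.
Local Open Scope classical_set_scope.
Local Open Scope ring_scope.

Section cost.
Context {R : realType} {n : nat}.
Implicit Types (f h : 'rV[R]_n -> R) (x v : 'rV[R]_n).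

Definition partial (i : 'I_n) f : 'rV[R]_n -> R := 'D_(delta_mx 0 i) f.

Definition C1 f := continuous f /\
  forall i, (forall x, derivable f x (delta_mx 0 i)) /\ continuous (partial i f).

Definition C2 f := C1 f /\ forall i, C1 (partial i f).

Definition hessian f x : 'M[R]_n := \matrix_(i, j) partial i (partial j f) x.

Definition dot (u v : 'rV[R]_n) : R := (u *m v^T) 0 0.

(* Vectors are rows, so [v *m A^T] stands for A v. *)
Definition posdefmx (A : 'M[R]_n) := forall v, v != 0 -> 0 < dot (v *m A^T) v.

(* The Euclidean sphere: the norm carried by 'rV[R]_n is the sup norm. *)
Definition unit_sphere : set 'rV[R]_n := [set x | dot x x = 1].

Definition pos_homogeneous (p : R) h :=
  forall (t : R) x, 0 < t -> h (t *: x) = t `^ p * h x.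

End cost.

Section multimap.
Context {R : realType} {n : nat}.
Implicit Types (T : 'rV[R]_n -> set 'rV[R]_n) (h : 'rV[R]_n -> R).

Definition mdom T : set 'rV[R]_n := [set x | T x != set0].

Definition mimage T (E : set 'rV[R]_n) : set 'rV[R]_n := \bigcup_(x in E) T x.

Definition h_monotone h T := forall x y, mdom T x -> mdom T y ->
  forall xi zeta, T x xi -> T y zeta ->
  h (x - xi) + h (y - zeta) <= h (x - zeta) + h (y - xi).

Definition maximal_h_monotone h T := h_monotone h T /\
  forall T', h_monotone h T' -> (forall x, T x `<=` T' x) -> T' = T.

Definition single_valued_on (D : set 'rV[R]_n) T :=
  forall x, D x -> exists xi, T x = [set xi].

End multimap.

Section lebesgue.
Context {R : realType} {n : nat}.
Implicit Types (a b : 'rV[R]_n) (E : set 'rV[R]_n).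

Definition box a b : set 'rV[R]_n :=
  [set x | forall i, a 0 i <= x 0 i <= b 0 i].

Definition box_volume a b : R := \prod_(i < n) (b 0 i - a 0 i).

Definition box_cover E : set (nat -> ('rV[R]_n * 'rV[R]_n)%type) :=
  [set B : nat -> ('rV[R]_n * 'rV[R]_n)%type | (forall k i, (B k).1 0 i <= (B k).2 0 i) /\
           E `<=` \bigcup_k box (B k).1 (B k).2].

(* Lebesgue outer measure; it is the Lebesgue measure on the Lebesgue
   measurable sets, i.e. on the sets satisfying Caratheodory's criterion. *)
Definition lebesgue E : \bar R := ereal_inf
  [set (\sum_(k <oo) (box_volume (B k).1 (B k).2)%:E)%E | B in box_cover E].

Definition lebesgue_measurable E := lebesgue.-caratheodory E.

End lebesgue.

Definition sigma_additive_on (R : realType) (X : Type) (S : set (set X))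
    (mu : set X -> \bar R) :=
  forall F : nat -> set X, (forall k, S (F k)) -> trivIset setT F ->
  (fun m => (\sum_(0 <= k < m) mu (F k))%E) @ \oo --> mu (\bigcup_k F k).

Definition measure_space (R : realType) (X : Type) (S : set (set X))
    (mu : set X -> \bar R) :=
  [/\ sigma_algebra setT S, mu set0 = 0%E,
      forall E, S E -> (0 <= mu E)%E & sigma_additive_on S mu].

(* Main.v *)
From HB Require Import structures.
Require Import Defs.
From mathcomp Require Import all_boot all_order all_algebra.
From mathcomp Require Import all_classical all_reals all_analysis.
From mathcomp Require Import ring lra.
Set Implicit Arguments.
Unset Strict Implicit.
Unset Printing Implicit Defensive.
Import Order.TTheory GRing.Theory Num.Theory.
Import numFieldNormedType.Exports.
Local Open Scope classical_set_scope.
Local Open Scope ring_scope.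

(** Taking images under [T] commutes with unions; it fails to commute with
    complements and to preserve disjointness only because a value may be taken
    at two distinct points. Two facts therefore suffice
    ([mimage_measure_space]): the range of [T] is measurable, and the set of
    values taken at least twice is Lebesgue negligible.

    The first holds because the graph of a maximal monotone map is closed
    ([closed_graph]): the closure of the graph is still monotone by continuity
    of the cost [h]. A closed subset of the product is a countable union of
    compact sets, and so is its projection, the range ([measurable_mimageT]).

    For the second, let [xi] be a value of [T] at [x] and at [y], with [x]
    different from [y]. Homogeneity extends the positivity of the Hessian of [h]
    from the sphere to every point but the origin, so [h] is strictly convex
    and its gradient is injective ([partial_separates]); hence
    [partial i h (y - xi) < partial i h (x - xi)] for some index [i], up to
    exchanging [x] and [y]. By continuity the strict inequality persists, with
    all variables independent, on small grid cubes around [x], [y] and [xi]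
    ([cells_separate]). Let [A] be the set of common values lying in the third
    cube of points of the first two. If [A] contained [xi] and
    [xi + t e_i] with [t > 0], monotonicity applied to a preimage of [xi] in the
    first cube and a preimage of [xi + t e_i] in the second, together with the
    mean value theorem, would give the opposite inequality between the two
    partial derivatives. So [A] meets each line of direction [e_i] at most once.
    It is also compact, and such a set is negligible, because its translates
    by [e_i / (k + 1)] are infinitely many disjoint sets of the same measure
    inside a bounded box ([lebesgue0_transversal], [doubly_hit_null]). Countably
    many cubes suffice ([overlap_null]).

    The remaining work is to prove that the outer measure defined by box covers
    is countably subadditive, invariant by translation, and makes closed sets
    measurable in the sense of Caratheodory, for which it is enough to cut boxes
    by coordinate hyperplanes ([halfspace_split]). *)

(** * Lebesgue outer measure of box covers *)

Section OuterMeasure.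
Context {R : realType}.

Section Volume.
Context {n : nat}.
Implicit Types (a b t : 'rV[R]_n) (E F : set 'rV[R]_n)
  (B : nat -> 'rV[R]_n * 'rV[R]_n).

Lemma box_volume_ge0 a b : (forall i, a 0 i <= b 0 i) -> 0 <= box_volume a b.
Proof. by move=> ab; apply: prodr_ge0 => i _; rewrite subr_ge0. Qed.

Lemma box_cover_volume_ge0 E B k : box_cover E B ->
  (0 <= (box_volume (B k).1 (B k).2)%:E)%E.
Proof. by case=> Bord _; rewrite lee_fin box_volume_ge0. Qed.

Lemma lebesgue_ge0 E : (0 <= lebesgue E)%E.
Proof.
apply: le_ereal_inf_tmp => _ [B coverB <-].
by apply: nneseries_ge0 => k _ _; exact: box_cover_volume_ge0 coverB.
Qed.

Lemma lebesgue_le_cover E B : box_cover E B ->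
  (lebesgue E <= \sum_(k <oo) (box_volume (B k).1 (B k).2)%:E)%E.
Proof. by move=> coverB; apply: ereal_inf_lbound; exists B. Qed.

Lemma le_lebesgue E F : E `<=` F -> (lebesgue E <= lebesgue F)%E.
Proof.
move=> EF; apply: le_ereal_inf_tmp => _ [B [Bord FB] <-].
by apply: lebesgue_le_cover; split => //; exact: subset_trans FB.
Qed.

Lemma lebesgue_sigma_subadditive : sigma_subadditive (@lebesgue R n).
Proof.
move=> F; have [[i ioo]|finF] := pselect (exists i, lebesgue (F i) = +oo%E).
  by rewrite (nneseries_pinfty _ _ ioo) ?leey// => k _; exact: lebesgue_ge0.
apply/lee_addgt0Pr => e e_gt0.
apply: le_trans (epsilon_trick _ _ (ltW e_gt0)); last first.
  by move=> k; exact: lebesgue_ge0.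
pose P k (B : nat -> 'rV[R]_n * 'rV[R]_n) := box_cover (F k) B /\
  (\sum_(j <oo) (box_volume (B j).1 (B j).2)%:E
     <= lebesgue (F k) + (e / (2 ^ k.+1)%:R)%:E)%E.
have [G GP] : {G & forall k, P k (G k)}.
  apply: (@choice _ _ P) => k.
  (* Each set is covered up to an error, and the errors sum to [e]. *)
  have ek_gt0 : 0 < e / (2 ^ k.+1)%:R by rewrite divr_gt0// ltr0n expn_gt0.
  have finFk : lebesgue (F k) \is a fin_num.
    rewrite ge0_fin_numE ?lebesgue_ge0// ltey.
    by apply/eqP => Fk_oo; apply: finF; exists k.
  have [_ [B coverB <-] volB] := lb_ereal_inf_adherent ek_gt0 finFk.
  by exists B; split => //; exact: ltW.
pose vol (kj : nat * nat) : \bar R :=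
  (box_volume (G kj.1 kj.2).1 (G kj.1 kj.2).2)%:E.
have vol_ge0 kj : (0 <= vol kj)%E.
  by apply: box_cover_volume_ge0; exact: (GP kj.1).1.
have /card_esym/ppcard_eqP[f] := card_nat2.
apply: (@le_trans _ _ (\sum_(m <oo) vol (f m))%E).
  apply: (@lebesgue_le_cover _ (fun m => G (f m).1 (f m).2)); split=> [m i|x].
    exact: (GP (f m).1).1.1.
  move=> [k _ /(GP k).1.2 [j _ xkj]].
  by exists (f^-1%FUN (k, j)) => //=; rewrite invK ?inE.
rewrite nneseries_esumT// -(reindex_esum setT [set: nat * nat] f vol)//.
rewrite -[setT](_ : [set: nat] `*`` (fun=> [set: nat]) = _); last first.
  by apply/seteqP; split.
rewrite -(@esum_esum _ _ _ setT (fun=> setT) (fun k j => vol (k, j)))//.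
rewrite -nneseries_esumT; last by move=> k; exact: esum_ge0.
apply: lee_nneseries => [k _ _|k _]; first exact: esum_ge0.
rewrite -nneseries_esumT//; exact: (GP k).2.
Qed.

Lemma box_volume_translate t a b : box_volume (a + t) (b + t) = box_volume a b.
Proof. by apply: eq_bigr => i _; rewrite !mxE opprD addrACA subrr addr0. Qed.

Lemma lebesgue_translate t E : lebesgue [set x + t | x in E] = lebesgue E.
Proof.
suff le_translate (s : 'rV[R]_n) F : (lebesgue [set (x + s)%R | x in F] <= lebesgue F)%E.
  apply/eqP; rewrite eq_le le_translate/=.
  rewrite [X in (lebesgue X <= _)%E](_ : E = [set (y - t)%R | y in [set (x + t)%R | x in E]]).
    exact: le_translate.
  apply/seteqP; split=> [x Ex|_ [_ [x Ex <-] <-]]; last by rewrite addrK.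
  by exists (x + t); [exists x|rewrite addrK].
apply: le_ereal_inf_tmp => _ [B [Bord FB] <-].
under eq_eseriesr do rewrite -(box_volume_translate s).
apply: (@lebesgue_le_cover _ (fun k => ((B k).1 + s, (B k).2 + s))).
split=> [k i|_ [x Fx <-]]; first by rewrite !mxE lerD2r.
have [k _ xk] := FB _ Fx; exists k => // i.
by rewrite /= !mxE !lerD2r.
Qed.

End Volume.

Section CutBox.
Context {n : nat}.
Implicit Types (a b : 'rV[R]_n) (i : 'I_n) (c : R).

Definition set_coord i c a : 'rV[R]_n := \row_j (if j == i then c else a 0 j).

Lemma set_coord_eq i c a : set_coord i c a 0 i = c.
Proof. by rewrite mxE eqxx. Qed.

Lemma set_coord_neq i c a j : j != i -> set_coord i c a 0 j = a 0 j.
Proof. by move=> /negPf ji; rewrite mxE ji. Qed.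

Lemma box_volume_cut i c a b :
  box_volume a b = box_volume a (set_coord i c b) + box_volume (set_coord i c a) b.
Proof.
have volE u v : box_volume u v = (v 0 i - u 0 i) * \prod_(j < n | j != i) (v 0 j - u 0 j).
  by rewrite /box_volume (bigD1 i).
rewrite !volE !set_coord_eq.
have eql : \prod_(j | j != i) (set_coord i c b 0 j - a 0 j)
    = \prod_(j | j != i) (b 0 j - a 0 j).
  by apply: eq_bigr => j ji; rewrite set_coord_neq.
have eqr : \prod_(j | j != i) (b 0 j - set_coord i c a 0 j)
    = \prod_(j | j != i) (b 0 j - a 0 j).
  by apply: eq_bigr => j ji; rewrite set_coord_neq.
by rewrite eql eqr -mulrDl [c - _ + _]addrC addrA subrK.
Qed.

(** Cutting every box of a cover by the hyperplane [x_i = c] costs no volume,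
    hence half-spaces split every set additively. The hypotheses cover both
    the open and the closed half-spaces. *)
Lemma halfspace_split i c (H X : set 'rV[R]_n) :
    (forall x, H x -> x 0 i <= c) -> (forall x, ~ H x -> c <= x 0 i) ->
  (lebesgue (X `&` H) + lebesgue (X `&` ~` H) <= lebesgue X)%E.
Proof.
move=> Hle Hge; apply: le_ereal_inf_tmp => _ [B coverB <-].
have [Bord XB] := coverB.
(* The cut is clamped to the box, so that both pieces are boxes. *)
pose cut k := Num.max ((B k).1 0 i) (Num.min ((B k).2 0 i) c).
have cut_bounds k : (B k).1 0 i <= cut k <= (B k).2 0 i.
  by rewrite /cut le_max lexx/= ge_max Bord ge_min lexx.
have coverl : box_cover (X `&` H)
    (fun k => ((B k).1, set_coord i (cut k) (B k).2)).
  split=> [k j|x [/XB[k _ xBk] /Hle xc]] /=.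
    by rewrite mxE; case: eqP => [->|_]; [case/andP: (cut_bounds k)|].
  exists k => // j; have /andP[-> xj] := xBk j.
  rewrite /= mxE; case: eqP xj => [->|//] xj.
  by rewrite /cut le_max le_min xj xc orbT.
have coverr : box_cover (X `&` ~` H)
    (fun k => (set_coord i (cut k) (B k).1, (B k).2)).
  split=> [k j|x [/XB[k _ xBk] /Hge cx]] /=.
    by rewrite mxE; case: eqP => [->|_]; [case/andP: (cut_bounds k)|].
  exists k => // j; have /andP[xj ->] := xBk j; rewrite andbT.
  rewrite /= mxE; case: eqP xj => [->|//] xj.
  by rewrite /cut ge_max ge_min xj cx orbT.
rewrite (eq_eseriesr (g := fun k =>
  ((box_volume (B k).1 (set_coord i (cut k) (B k).2))%:E +
   (box_volume (set_coord i (cut k) (B k).1) (B k).2)%:E)%E)); last first.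
  by move=> k _; rewrite -EFinD -box_volume_cut.
rewrite nneseriesD => [|k _ _|k _ _].
- by apply: leeD; [exact: (lebesgue_le_cover coverl)|exact: (lebesgue_le_cover coverr)].
- exact: (box_cover_volume_ge0 k coverl).
- exact: (box_cover_volume_ge0 k coverr).
Qed.

End CutBox.

Section BoundedBox.
Context {n : nat}.
Implicit Types (a b : 'rV[R]_n.+1).

(** Only a positive dimension makes this true: the empty product is 1. It lets
    finite covers be completed to the infinite ones of the definition. *)
Lemma box_volume_degenerate a : box_volume a a = 0.
Proof. by rewrite /box_volume big_ord_recl subrr mul0r. Qed.

Lemma lebesgue_set0 : lebesgue (set0 : set 'rV[R]_n.+1) = 0%E.
Proof.
apply/eqP; rewrite eq_le lebesgue_ge0 andbT.
apply: le_trans (_ : \sum_(k <oo) (box_volume (0 : 'rV[R]_n.+1) 0)%:E <= _)%E.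
  by apply: (@lebesgue_le_cover _ _ (fun=> (0, 0))); split.
by rewrite eseries0// => k _ _; rewrite box_volume_degenerate.
Qed.

Lemma lebesgue_box_lty a b : (forall i, a 0 i <= b 0 i) ->
  (lebesgue (box a b) < +oo)%E.
Proof.
move=> ab; pose B k : 'rV[R]_n.+1 * 'rV[R]_n.+1 := if k is 0%N then (a, b) else (0, 0).
have coverB : box_cover (box a b) B.
  by split=> [[|k] i //=|x xab]; exists 0%N.
apply: le_lt_trans (lebesgue_le_cover coverB) _.
rewrite nneseries_recl//; last by move=> k _; exact: box_cover_volume_ge0 coverB.
rewrite eseries0 ?adde0 ?ltry// => -[|k]//= _ _.
by rewrite box_volume_degenerate.
Qed.

End BoundedBox.
End OuterMeasure.

(** * Lebesgue measurable sets *)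

HB.instance Definition _ (R : realType) (n : nat) :=
  isOuterMeasure.Build R 'rV[R]_n.+1 (@lebesgue R n.+1)
    lebesgue_set0 lebesgue_ge0 (@le_lebesgue R n.+1) lebesgue_sigma_subadditive.

Section Measurability.
Context {R : realType} {n : nat}.
Implicit Types (a b x : 'rV[R]_n.+1) (A E U : set 'rV[R]_n.+1).

Local Notation mleb := (@lebesgue R n.+1).-cara.-measurable.

Lemma measurable_halfspace_le i (c : R) :
  mleb [set x : 'rV[R]_n.+1 | x 0 i <= c].
Proof.
apply: le_caratheodory_measurable => X; apply: (@halfspace_split _ _ i c) => x //=.
by move=> /negP; rewrite -ltNge => /ltW.
Qed.

Lemma measurable_halfspace_ge i (c : R) :
  mleb [set x : 'rV[R]_n.+1 | c <= x 0 i].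
Proof.
rewrite -[X in mleb X]setCK; apply: measurableC.
apply: le_caratheodory_measurable => X; apply: (@halfspace_split _ _ i c) => x /=.
  by move=> /negP; rewrite -ltNge => /ltW.
by move=> /contrapT.
Qed.

Lemma measurable_box a b : mleb (box a b).
Proof.
rewrite (_ : box a b = \bigcap_(i in [set: 'I_n.+1])
    ([set x : 'rV[R]_n.+1 | a 0 i <= x 0 i] `&` [set x | x 0 i <= b 0 i])); last first.
  apply/seteqP; split=> x xab i; first by move=> _; have /andP[] := xab i.
  by have [/= -> ->] := xab i I.
apply: fin_bigcap_measurable => [|i _]; [exact: finite_finset|apply: measurableI].
  exact: measurable_halfspace_ge.
exact: measurable_halfspace_le.
Qed.

(** The closed grid cubes of side [1 / (k + 1)], for all [k]: a countable family
    of compact convex sets that plays the role of a countable basis. *)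
Definition cell (kz : nat * 'rV[int]_n.+1) : set 'rV[R]_n.+1 :=
  box (\row_j ((kz.2 0 j)%:~R / kz.1.+1%:R))
      (\row_j ((kz.2 0 j + 1)%:~R / kz.1.+1%:R)).

Lemma cell_nbhs x U : nbhs x U -> exists2 kz, cell kz x & cell kz `<=` U.
Proof.
move=> /nbhs_ballP[e /= e_gt0 xeU].
have [k _ /(_ k (leqnn k)) /= ke] := near_infty_natSinv_lt (PosNum e_gt0).
have k_gt0 : 0 < k.+1%:R :> R by rewrite ltr0n.
exists (k, \row_j Num.floor (x 0 j * k.+1%:R)).
  move=> j; rewrite !mxE /= ler_pdivrMr// ler_pdivlMr//.
  by rewrite floor_le//= ltW// floorD1_gt.
move=> y xy; apply: xeU; split=> // i j; rewrite ord1 /ball /=.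
have := xy j; rewrite !mxE /= ler_pdivrMr// ler_pdivlMr// => /andP[yl yu].
set m := Num.floor _ in yl yu.
have xl : m%:~R <= x 0 j * k.+1%:R by rewrite floor_le.
have xu : x 0 j * k.+1%:R < (m + 1)%:~R by rewrite floorD1_gt.
rewrite intrD in xu yu.
apply: le_lt_trans ke; rewrite -[leRHS]mul1r ler_pdivlMr//.
rewrite -[k.+1%:R]gtr0_norm// -normrM ler_norml mulrBl.
lra.
Qed.

Lemma measurable_open U : open U -> mleb U.
Proof.
move=> oU; rewrite (_ : U = \bigcup_(kz : nat * 'rV[int]_n.+1)
    (if `[< cell kz `<=` U >] then cell kz else set0)); last first.
  apply/seteqP; split=> [x Ux|x [kz _]]; last by case: asboolP => // + ?; exact.
  have [kz xkz kzU] := cell_nbhs (open_nbhs_nbhs (conj oU Ux)).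
  by exists kz => //; case: asboolP.
apply: countable_bigcupT_measurable => // kz.
by case: ifP => // _; exact: measurable_box.
Qed.

Lemma measurable_closed A : closed A -> mleb A.
Proof.
by move=> cA; rewrite -[A]setCK; apply/measurableC/measurable_open/closed_openC.
Qed.

Lemma subset_lebesgue0 A E : A `<=` E -> lebesgue E = 0%E -> lebesgue A = 0%E.
Proof.
by move=> AE E0; apply/eqP; rewrite eq_le lebesgue_ge0 andbT -E0 le_lebesgue.
Qed.

Lemma lebesgue0_measurable A : lebesgue A = 0%E -> mleb A.
Proof.
move=> A0; apply: le_caratheodory_measurable => X /=.
rewrite (subset_lebesgue0 (@subIsetr _ X A) A0) add0e.
by apply: le_lebesgue; exact: subIsetl.
Qed.

Lemma lebesgue_setD_null A E : lebesgue A = 0%E -> lebesgue (E `\` A) = lebesgue E.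
Proof.
move=> A0; rewrite setDE [RHS](lebesgue0_measurable A0).
by rewrite /= (subset_lebesgue0 (@subIsetr _ E A) A0) add0e.
Qed.

Lemma lebesgue0_bigcup (I : countType) (F : I -> set 'rV[R]_n.+1) :
  (forall i, lebesgue (F i) = 0%E) -> lebesgue (\bigcup_i F i) = 0%E.
Proof.
move=> F0; pose G k := if unpickle k is Some i then F i else set0.
apply/eqP; rewrite eq_le lebesgue_ge0 andbT.
have FG : \bigcup_i F i `<=` \bigcup_k G k.
  by move=> x [i _ Fx]; exists (pickle i); rewrite // /G pickleK.
apply: le_trans (le_lebesgue FG) _.
apply: le_trans (lebesgue_sigma_subadditive _) _.
by rewrite eseries0// => k _ _; rewrite /G; case: unpickle => // _; exact: lebesgue_set0.
Qed.

Lemma lebesgue_sigma_additive :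
  sigma_additive_on (@lebesgue R n.+1).-caratheodory (@lebesgue R n.+1).
Proof.
move=> F mF tF; apply: caratheodory_measure_sigma_additive => //.
exact: bigcupT_measurable.
Qed.

Lemma translate_continuous t : continuous (fun x : 'rV[R]_n.+1 => x - t).
Proof.
move=> x; apply: (@cvgB R 'rV[R]_n.+1 _ (nbhs x) _ id (fun=> t)); first exact: cvg_id.
exact: cvg_cst.
Qed.

(** A bounded closed set meeting each line of direction [e_i] at most once has
    infinitely many pairwise disjoint translates, all of the same measure, in
    a bounded box: its measure is zero. *)
Lemma lebesgue0_transversal i a b A : closed A -> A `<=` box a b ->
    (forall x t, A x -> A (x + t *: delta_mx 0 i) -> t = 0) ->
  lebesgue A = 0%E.
Proof.
move=> cA Aab Ai; apply: contrapT => A_neq0.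
pose s k : 'rV[R]_n.+1 := k.+1%:R^-1 *: delta_mx 0 i.
pose F k := [set x + s k | x in A].
have FE k : F k = (fun y => y - s k) @^-1` A.
  apply/seteqP; split=> [_ [x Ax <-]|y Ay] /=; first by rewrite addrK.
  by exists (y - s k); rewrite ?subrK.
have mF k : mleb (F k).
  apply: measurable_closed; rewrite FE; apply: preimage_closed => // y _.
  exact: translate_continuous.
have tF : trivIset setT F.
  apply/trivIsetP => k j _ _ kj; apply/seteqP; split=> // y [].
  rewrite !FE /= => Ak Aj; move/eqP: kj; apply.
  have := Ai _ (k.+1%:R^-1 - j.+1%:R^-1) Ak.
  rewrite scalerBl -/(s k) -/(s j) addrA subrK => /(_ Aj)/eqP.
  by rewrite subr_eq0 => /eqP/invr_inj/eqP; rewrite eqr_nat => /eqP[].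
have Fbox : \bigcup_k F k `<=` box a (b + const_mx 1).
  move=> _ [k _ [x /Aab xab <-]] j; have /andP[ax xb] := xab j.
  rewrite !mxE eqxx/=; apply/andP; split.
    by rewrite (le_trans ax)// lerDl mulr_ge0// ler0n.
  apply: lerD => //; case: (j == i); rewrite ?mulr0// mulr1.
  by rewrite invf_le1 ?ler1n// ltr0n.
have [x0 /Aab x0ab] : A !=set0.
  by apply/set0P/eqP => A0; apply: A_neq0; rewrite A0 lebesgue_set0.
have sumF : (\sum_(k <oo) lebesgue (F k) < +oo)%E.
  rewrite (cvg_lim _ (lebesgue_sigma_additive mF tF))//.
  apply: le_lt_trans (le_lebesgue Fbox) _; apply: lebesgue_box_lty => j.
  have /andP[/le_trans ax /ax ab] := x0ab j.
  by rewrite !mxE (le_trans ab)// lerDl.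
have tail0 := nneseries_tail_cvg sumF (fun k _ => lebesgue_ge0 (F k)).
apply: A_neq0; apply/eqP; rewrite eq_le lebesgue_ge0 andbT.
apply: (cvge_ge _ tail0); apply: nearW => N.
apply: le_trans (nneseries_lim_ge N.+1 (fun k _ _ => lebesgue_ge0 (F k))).
by rewrite big_nat1 lebesgue_translate.
Qed.

End Measurability.

(** * Directional derivatives *)

Section DirectionalDerivatives.
Context {R : realType} {n : nat}.
Implicit Types (f : 'rV[R]_n -> R) (x v w u : 'rV[R]_n) (c s t p : R).

Lemma is_derive_ray f x v c s : derivable f (x + (s * c) *: v) v ->
  is_derive s 1 (fun r => f (x + (r * c) *: v)) (c * 'D_v f (x + (s * c) *: v)).
Proof.
move=> fv; pose g r := f (x + r *: v).
have quotE : (fun h : R => h^-1 *: ((g \o shift (s * c)) (h *: 1) - g (s * c)))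
    = (fun h => h^-1 *: ((f \o shift (x + (s * c) *: v)) (h *: v)
         - f (x + (s * c) *: v))).
  apply/funext => r; congr (_ *: (_ - _)); rewrite /g /=; congr f.
  by rewrite scalerDl addrCA [r *: 1]mulr1.
have g_drv : is_derive (s * c) 1 g ('D_v f (x + (s * c) *: v)).
  by split; rewrite /derivable ?/derive quotE.
have c_drv : is_derive s 1 (fun r : R => r * c) c.
  rewrite (_ : (fun r => _) = c *: id); last by apply/funext => r; exact: mulrC.
  by have := is_deriveZ c (is_derive_id s (1:R)); rewrite [c *: 1]mulr1.
have := @is_derive1_comp _ g ( *%R^~ c) s _ _ g_drv c_drv.
by rewrite mulrC.
Qed.

Lemma mvt_direction f x v t : (forall y, derivable f y v) ->
  exists2 s, 0 <= s <= 1 & f (x + t *: v) - f x = t * 'D_v f (x + (s * t) *: v).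
Proof.
move=> fv; pose g r := f (x + (r * t) *: v).
have g_drv s : is_derive s 1 g (t * 'D_v f (x + (s * t) *: v)).
  exact: is_derive_ray.
have [s s01 gE] := @MVT _ g _ 0 1 ltr01 (fun s _ => g_drv s)
  (derivable_within_continuous (fun s _ => @ex_derive _ _ _ _ _ _ _ (g_drv s))).
exists s; first by move: s01; rewrite in_itv/= => /andP[/ltW-> /ltW->].
by move: gE; rewrite /g mul1r mul0r scale0r addr0 subr0 mulr1.
Qed.

(** The increment along [u + c w] is the increment along [u] followed by one
    along [w], which the mean value theorem evaluates at points tending to
    [x]; continuity of ['D_w f] gives the limit. *)
Lemma is_derive_add f x u w c df : is_derive x u f df ->
    (forall y, derivable f y w) -> continuous ('D_w f) ->
  is_derive x (u + c *: w) f (df + c * 'D_w f x).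
Proof.
move=> fu fw Dw_cont.
have [s s01 sE] : {s : R -> R & forall r, 0 <= s r <= 1 &
    forall r, f (x + r *: u + (r * c) *: w) - f (x + r *: u)
      = (r * c) * 'D_w f (x + r *: u + (s r * (r * c)) *: w)}.
  pose P r s := 0 <= s <= 1 /\ f (x + r *: u + (r * c) *: w) - f (x + r *: u)
      = (r * c) * 'D_w f (x + r *: u + (s * (r * c)) *: w).
  have [s sP] : {s & forall r, P r (s r)}.
    apply: (@choice _ _ P) => r.
    by have [s s01 sE] := mvt_direction (x + r *: u) (r * c) fw; exists s.
  by exists s => r; have [] := sP r.
have quot_cvg : h^-1 *: ((f \o shift x) (h *: (u + c *: w)) - f x) @[h --> 0^']
    --> df + c * 'D_w f x.
  have r0 : r @[r --> (0 : R)^'] --> (0 : R) by exact: cvg_within.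
  have sr0 : s r * (r * c) @[r --> (0 : R)^'] --> (0 : R).
    apply/cvgr0Pnorm_le => e e_gt0.
    have : (r * c) @[r --> (0 : R)^'] --> (0 : R).
      by rewrite -[X in _ --> X](mul0r c); apply: cvgM => //; exact: cvg_cst.
    move/cvgr0Pnorm_le => /(_ _ e_gt0); apply: filterS => r.
    apply: le_trans; rewrite normrM ler_piMl//.
    by have /andP[s_ge0 s_le1] := s01 r; rewrite ger0_norm.
  have pt_cvg : x + r *: u + (s r * (r * c)) *: w @[r --> (0 : R)^'] --> x.
    have xE : x + 0 *: u + 0 *: w = x by rewrite !scale0r !addr0.
    rewrite -[X in _ --> X]xE.
    apply: (@cvgD _ _ _ _ _ (fun r => x + r *: u) (fun r => (s r * (r * c)) *: w)).
      apply: (@cvgD _ _ _ _ _ (fun=> x) (fun r => r *: u)); first exact: cvg_cst.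
      exact: cvgZr_tmp.
    exact: cvgZr_tmp.
  have fu_cvg : h^-1 *: ((f \o shift x) (h *: u) - f x) @[h --> 0^'] --> df.
    by rewrite -(@derive_val _ _ _ _ _ _ _ fu); exact: ex_derive.
  have sum_cvg : h^-1 *: ((f \o shift x) (h *: u) - f x)
      + c * 'D_w f (x + h *: u + (s h * (h * c)) *: w) @[h --> 0^']
      --> df + c * 'D_w f x.
    apply: cvgD => //; apply: cvgM; first exact: cvg_cst.
    exact: (cvg_comp _ _ pt_cvg (Dw_cont x)).
  apply: cvg_trans sum_cvg; apply: near_eq_cvg.
  near=> r; have r_neq0 : r != 0 by near: r; exact: nbhs_dnbhs_neq.
  have argE : r *: (u + c *: w) + x = x + r *: u + (r * c) *: w.
    by rewrite scalerDr scalerA addrC addrA.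
  have fE : f (x + r *: u + (r * c) *: w)
      = f (x + r *: u) + (r * c) * 'D_w f (x + r *: u + (s r * (r * c)) *: w).
    by rewrite -sE [RHS]addrC subrK.
  by rewrite /= argE fE [r *: u + x]addrC /GRing.scale /=; field.
split; first by apply/cvg_ex; exists (df + c * 'D_w f x).
exact: cvg_lim quot_cvg.
Unshelve. all: by end_near. Qed.

(** A vector is a sum of multiples of the basis vectors, added one at a time. *)
Lemma is_derive_C1 f x v : C1 f ->
  is_derive x v f (\sum_i v 0 i * partial i f x).
Proof.
case=> _ f_C1; rewrite {1}[v]row_sum_delta.
elim: (index_enum _) => [|i r IH].
  have quotE : (fun h => h^-1 *: ((f \o shift x) (h *: 0) - f x)) = cst 0.
    by apply/funext => h /=; rewrite scaler0 add0r subrr scaler0.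
  rewrite !big_nil; split; first by rewrite /derivable quotE; exact: is_cvg_cst.
  by rewrite /derive quotE lim_cst.
rewrite !big_cons addrC [X in is_derive _ _ _ X]addrC.
by apply: is_derive_add => // [y|]; have [] := f_C1 i.
Qed.

Lemma pos_homogeneous_derive f p v : (forall x, derivable f x v) ->
  pos_homogeneous p f -> pos_homogeneous (p - 1) ('D_v f).
Proof.
move=> fv f_hom t x t_gt0.
have drv c y : is_derive (0 : R) (1 : R) (fun r => f (y + (r * c) *: v)) (c * 'D_v f y).
  by have := @is_derive_ray f y v c 0 (fv _); rewrite mul0r scale0r addr0.
(* The ray through [t x] is the image by scaling of the ray through [x];
   the two derivatives at 0 of this function are compared. *)
have rayE : (fun r => f (t *: x + (r * t) *: v))
    = t `^ p *: (fun r => f (x + (r * 1) *: v)).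
  apply/funext => r; rewrite -[RHS]/(t `^ p * _) -f_hom//.
  by rewrite scalerDr scalerA mulr1 [t * r]mulrC.
have eq_drv : t * 'D_v f (t *: x) = t `^ p * (1 * 'D_v f x).
  rewrite -(@derive_val _ _ _ _ _ _ _ (drv t (t *: x))) rayE.
  exact: (@derive_val _ _ _ _ _ _ _ (is_deriveZ (t `^ p) (drv 1 x))).
apply: (mulfI (lt0r_neq0 t_gt0)); rewrite eq_drv mul1r mulrA; congr (_ * _).
transitivity (t `^ (p - 1 + 1)); first by rewrite subrK.
by rewrite powRD ?(lt0r_neq0 t_gt0) ?implybT// powRr1 ?(ltW t_gt0)// mulrC.
Qed.

End DirectionalDerivatives.

(** * Injectivity of the gradient of the cost *)

Section GradientMonotone.
Context {R : realType} {n : nat}.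
Context (p : R) (h : 'rV[R]_n -> R).
Context (h_C2 : C2 h) (h_hom : pos_homogeneous p h)
  (h_hess : forall x : 'rV[R]_n, unit_sphere x -> posdefmx (hessian h x)).
Implicit Types (x y v : 'rV[R]_n) (i j : 'I_n).

Let partial_derivable i x : derivable h x (delta_mx 0 i).
Proof. by case: h_C2 => -[_ /(_ i)[]]. Qed.

Let partial2_derivable i j x : derivable (partial j h) x (delta_mx 0 i).
Proof. by case: h_C2 => _ /(_ j)[_ /(_ i)[]]. Qed.

Lemma dot_gt0 x : x != 0 -> 0 < dot x x.
Proof.
move=> x_neq0; rewrite /dot mxE lt_def sumr_ge0 ?andbT; last first.
  by move=> i _; rewrite mxE -expr2 sqr_ge0.
apply: contraNneq x_neq0 => sum0; apply/eqP/rowP => i.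
have sq_ge0 j : true -> 0 <= x 0 j * x^T j 0 by rewrite mxE -expr2 sqr_ge0.
have := psumr_eq0P sq_ge0 sum0 (i := i) isT.
by rewrite !mxE -expr2 => /eqP; rewrite sqrf_eq0 => /eqP.
Qed.

Lemma hessian_hom t x : 0 < t -> hessian h (t *: x) = t `^ (p - 2) *: hessian h x.
Proof.
move=> t_gt0; apply/matrixP => i j; rewrite !mxE.
have hom1 : pos_homogeneous (p - 1) (partial j h).
  exact: pos_homogeneous_derive.
have /(_ t x t_gt0) := pos_homogeneous_derive (@partial2_derivable i j) hom1.
by rewrite -[p - 1 - 1]addrA -opprD.
Qed.

(** Homogeneity carries positivity of the Hessian from the sphere to the whole
    punctured space. *)
Lemma hessian_posdef x : x != 0 -> posdefmx (hessian h x).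
Proof.
move=> /dot_gt0 x_gt0 v v_neq0; pose r := Num.sqrt (dot x x).
have r_gt0 : 0 < r by rewrite sqrtr_gt0.
have sphere_x : unit_sphere (r^-1 *: x).
  rewrite /unit_sphere /= /dot -scalemxAl linearZ/= -scalemxAr scalerA mxE.
  by rewrite -invfM -expr2 sqr_sqrtr ?ltW// mulVf// lt0r_neq0.
rewrite -[x](scalerKV (lt0r_neq0 r_gt0)) hessian_hom//.
rewrite /dot linearZ/= -scalemxAr -scalemxAl mxE mulr_gt0 ?powR_gt0//.
exact: h_hess.
Qed.

(* The derivative of [s |-> h (x + s v)]; the factor 1 is the speed of the ray
   in [is_derive_ray]. *)
Let slope x v (s : R) : R := \sum_j v 0 j * partial j h (x + (s * 1) *: v).

Let slope_derive x v (s : R) :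
  is_derive s (1 : R) (slope x v) (dot (v *m (hessian h (x + s *: v))^T) v).
Proof.
rewrite /slope.
have drv j : is_derive s (1 : R) (fun s => v 0 j * partial j h (x + (s * 1) *: v))
    (v 0 j * \sum_i v 0 i * partial i (partial j h) (x + s *: v)).
  have C1j : C1 (partial j h) by case: h_C2.
  have := @is_derive_ray _ _ (partial j h) x v 1 s.
  have D := is_derive_C1 (x + (s * 1) *: v) v C1j.
  move=> /(_ (@ex_derive _ _ _ _ _ _ _ D)).
  rewrite (@derive_val _ _ _ _ _ _ _ D) mul1r !mulr1 => drv.
  exact: (is_deriveZ (v 0 j) drv).
rewrite (_ : (fun s => _) = \sum_j
    (fun s => v 0 j * partial j h (x + (s * 1) *: v))); last first.
  by apply/funext => r; rewrite fct_sumE.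
apply: is_derive_eq (is_derive_sum _) _.
rewrite /dot mxE; under [RHS]eq_bigr => i _ do rewrite mxE mulr_suml.
rewrite exchange_big; apply: eq_bigr => j _; rewrite /= mulr_sumr.
apply: eq_bigr => i _; rewrite [v^T _ _]mxE [_^T _ _]mxE [hessian _ _ _ _]mxE.
by rewrite mulrA [RHS]mulrAC.
Qed.

Let grad_lt_ray x v : v != 0 -> (forall s, 0 < s < 1 -> x + s *: v != 0) ->
  \sum_j v 0 j * partial j h x < \sum_j v 0 j * partial j h (x + v).
Proof.
move=> v_neq0 ray_neq0.
have [s s01 slopeE] := @MVT _ (slope x v) _ 0 1 ltr01 (fun s _ => slope_derive x v s)
  (derivable_within_continuous
    (fun s _ => @ex_derive _ _ _ _ _ _ _ (slope_derive x v s))).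
move: slopeE; rewrite /slope !mulr1 subr0 scale1r scale0r addr0 mulr1 => slopeE.
rewrite -subr_gt0 slopeE; apply: hessian_posdef v_neq0.
by apply: ray_neq0; move: s01; rewrite in_itv.
Qed.

(** Strict convexity of the cost, expressed on its gradient. The Hessian may
    degenerate at the origin only, so a segment through it is split there. *)
Lemma grad_lt x y : x != y ->
  \sum_j (y - x) 0 j * partial j h x < \sum_j (y - x) 0 j * partial j h y.
Proof.
move=> xy; have v_neq0 : y - x != 0 by rewrite subr_eq0 eq_sym.
have [[s /andP[s_gt0 s_lt1] s0]|no0] :=
    pselect (exists2 s, 0 < s < 1 & x + s *: (y - x) = 0); last first.
  have := @grad_lt_ray x (y - x) v_neq0; rewrite [x + _]addrC subrK; apply => s s01.
  by apply/eqP => s0; apply: no0; exists s.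
have half u c : 0 < c -> (forall r, 0 < r < 1 -> u + (r * c) *: (y - x) != 0) ->
    \sum_j (y - x) 0 j * partial j h u
      < \sum_j (y - x) 0 j * partial j h (u + c *: (y - x)).
  move=> c_gt0 u_neq0; have cv_neq0 : c *: (y - x) != 0.
    by rewrite scaler_eq0 negb_or (lt0r_neq0 c_gt0).
  have cvE z : \sum_j (c *: (y - x)) 0 j * partial j h z
      = c * \sum_j (y - x) 0 j * partial j h z.
    by rewrite mulr_sumr; apply: eq_bigr => j _; rewrite mxE mulrA.
  rewrite -(ltr_pM2l c_gt0) -!cvE; apply: grad_lt_ray => // r r01.
  by rewrite scalerA; exact: u_neq0.
have xE : x = - (s *: (y - x)) by apply/eqP; rewrite -addr_eq0 s0.
have neq0 c : c != 0 -> c *: (y - x) != 0.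
  by move=> c_neq0; rewrite scaler_eq0 negb_or c_neq0.
apply: (@lt_trans _ _ (\sum_j (y - x) 0 j * partial j h 0)).
  rewrite -s0; apply: half => // r /andP[_ r_lt1].
  rewrite {1}xE -scaleNr -scalerDl; apply: neq0.
  by rewrite addrC subr_eq0 lt_eqF// gtr_pMl.
have yE : 0 + (1 - s) *: (y - x) = y.
  by rewrite add0r scalerBl scale1r -xE subrK.
have := half 0 (1 - s); rewrite yE; apply=> [|r /andP[r_gt0 _]].
  by rewrite subr_gt0.
by rewrite add0r neq0// mulf_neq0 ?lt0r_neq0// subr_gt0.
Qed.

Lemma partial_separates x y : x != y -> exists i, partial i h x != partial i h y.
Proof.
move=> xy; apply: contrapT => /forallNP eq_partial.
have := grad_lt xy; rewrite lt_neqAle => /andP[+ _]; apply/negP/negPn/eqP.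
by apply: eq_bigr => j _; have /negP/negPn/eqP -> := eq_partial j.
Qed.

End GradientMonotone.

(** * Monotone maps *)

Section MonotoneMaps.
Context {R : realType} {n : nat}.
Implicit Types (x y xi zeta a b c d : 'rV[R]_n.+1) (E A : set 'rV[R]_n.+1)
  (T : 'rV[R]_n.+1 -> set 'rV[R]_n.+1) (h : 'rV[R]_n.+1 -> R).

Local Notation mleb := (@lebesgue R n.+1).-cara.-measurable.
Local Notation V := 'rV[R]_n.+1.

Definition graph T : set (V * V) := [set z | T z.1 z.2].

Lemma sub_continuous : continuous (fun z : V * V => z.1 - z.2).
Proof.
move=> z; apply: (@cvgB R V _ (nbhs z) _ fst snd); [exact: cvg_fst|exact: cvg_snd].
Qed.

(** The two sides of the monotonicity inequality are continuous in each of the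
    two graph points, so the closure of a monotone graph is monotone. *)
Lemma closed_graph h T : continuous h -> maximal_h_monotone h T ->
  closed (graph T).
Proof.
move=> h_cont [T_mon T_max].
have T_monE z w : graph T z -> graph T w ->
    h (z.1 - z.2) + h (w.1 - w.2) <= h (z.1 - w.2) + h (w.1 - z.2).
  by move=> Tz Tw; apply: T_mon => //; apply/set0P; [exists z.2|exists w.2].
pose good w := [set z : V * V |
  h (z.1 - z.2) + h (w.1 - w.2) <= h (z.1 - w.2) + h (w.1 - z.2)].
have good_closed w : closed (good w).
  pose gap (z : V * V) := h (z.1 - w.2) + h (w.1 - z.2)
    - (h (z.1 - z.2) + h (w.1 - w.2)).
  rewrite (_ : good w = gap @^-1` [set r | 0 <= r]); last first.
    by apply/seteqP; split=> z; rewrite /good /gap /= subr_ge0.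
  apply: preimage_closed; last exact: closed_ge.
  have comp_cont (f g : V * V -> V) : continuous f -> continuous g ->
      continuous (fun z => h (f z - g z)).
    move=> f_cont g_cont z; apply: (@cvg_comp _ _ _ (fun z => f z - g z) h).
      exact: (@cvgB R V _ (nbhs z) _ f g _ _ (f_cont z) (g_cont z)).
    exact: h_cont.
  have fst_cont : continuous (fst : V * V -> V) by move=> z; exact: cvg_fst.
  have snd_cont : continuous (snd : V * V -> V) by move=> z; exact: cvg_snd.
  have cst_cont v : continuous (fun _ : V * V => v : V) by move=> z; exact: cvg_cst.
  move=> z _; exact: (cvgB
    (cvgD (comp_cont _ _ fst_cont (cst_cont w.2) z)
          (comp_cont _ _ (cst_cont w.1) snd_cont z))
    (cvgD (comp_cont _ _ fst_cont snd_cont z) (cvg_cst _))).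
have closure_good w : (forall z, graph T z -> good w z) ->
    closure (graph T) `<=` good w.
  by move=> good_w; rewrite closureE; exact: smallest_sub.
have goodC z w : good w z -> good z w.
  by rewrite /good /= [X in X <= _ -> _]addrC [X in _ <= X -> _]addrC.
pose T' x := [set xi | closure (graph T) (x, xi)].
have T'_mon : h_monotone h T'.
  move=> x y _ _ xi zeta clx cly.
  apply: (closure_good (y, zeta) _ (x, xi) clx) => z Tz.
  apply: goodC; apply: (closure_good z _ (y, zeta) cly) => w Tw.
  exact: T_monE.
have T'E : T' = T by apply: T_max => // x xi Txi; exact: subset_closure.
apply/closure_id/seteqP; split; first exact: subset_closure.
by move=> [x xi] cl_xi; rewrite /graph /= -T'E.
Qed.

Lemma box_compact a b : compact (box a b).
Proof.
exact: (@rV_compact R n.+1 (fun i => `[a 0 i, b 0 i]%classic)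
  (fun i => @segment_compact R _ _)).
Qed.

(** Projecting along a compact factor preserves closedness. *)
Lemma projection_closed (G : set (V * V)) a b c d : closed G ->
  closed [set xi | box c d xi /\ exists2 x, box a b x & G (x, xi)].
Proof.
move=> G_closed; apply: compact_closed; first exact: norm_hausdorff.
rewrite (_ : [set xi | _] = snd @` (G `&` (box a b `*` box c d))); last first.
  apply/seteqP; split=> [xi [xicd [x xab Gx]]|_ [[x xi] [Gx [xab xicd]] <-]].
    by exists (x, xi).
  by split => //; exists x.
apply: continuous_compact; first by apply: continuous_subspaceT => z; exact: cvg_snd.
by rewrite setIC; apply/compact_closedI/G_closed/compact_setX; exact: box_compact.
Qed.

(** The range is the projection of a closed, hence sigma-compact, subset of the
    product; here the compact pieces are products of two grid cubes. *)
Lemma measurable_mimageT T : closed (graph T) -> mleb (mimage T setT).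
Proof.
move=> T_closed; rewrite (_ : mimage T setT =
    \bigcup_(km : (nat * 'rV[int]_n.+1) * (nat * 'rV[int]_n.+1))
      [set xi | cell km.2 xi /\ exists2 x, cell km.1 x & graph T (x, xi)]); last first.
  apply/seteqP; split=> [xi [x _ Txi]|xi [km _ [_ [x _ Txi]]]]; last by exists x.
  have [k kx _] := cell_nbhs (filterT : nbhs x setT).
  have [m mxi _] := cell_nbhs (filterT : nbhs xi setT).
  by exists (k, m) => //; split=> //; exists x.
apply: countable_bigcupT_measurable => // km; apply: measurable_closed.
exact: projection_closed.
Qed.

(** The points [xi] and [zeta] are independent because the mean value theorem,
    applied at [x] and at [y], yields unrelated intermediate points. *)
Definition separates h i (k l m : nat * 'rV[int]_n.+1) := forall x y xi zeta,
  cell k x -> cell l y -> cell m xi -> cell m zeta ->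
  partial i h (y - zeta) < partial i h (x - xi).

Definition doubly_hit T (k l m : nat * 'rV[int]_n.+1) : set V := [set xi |
  [/\ cell m xi, exists2 x, cell k x & T x xi & exists2 y, cell l y & T y xi]].

Lemma box_segment i a b x (t r : R) : box a b x -> box a b (x + t *: delta_mx 0 i) ->
  0 <= r <= t -> box a b (x + r *: delta_mx 0 i).
Proof.
move=> xab xtab /andP[r_ge0 rt] j; have := xtab j; have := xab j; rewrite !mxE /=.
case: (j == i); rewrite ?mulr0 ?mulr1 ?addr0// => /andP[ax _] /andP[_ xb].
by rewrite (le_trans ax) ?lerDl//= (le_trans _ xb)// lerD2l.
Qed.

(** If two points of the set differ by [t e_i] with [t > 0], monotonicity
    compares the increments of the cost along [t e_i] at the two preimages in
    the order opposite to the one imposed by the separated partial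
    derivatives. *)
Lemma doubly_hit_null h i T k l m : (forall x, derivable h x (delta_mx 0 i)) ->
  h_monotone h T -> closed (graph T) -> separates h i k l m ->
  lebesgue (doubly_hit T k l m) = 0%E.
Proof.
move=> h_drv T_mon T_closed sep; set A := doubly_hit T k l m.
have A_closed : closed A.
  rewrite (_ : A = [set xi | cell m xi /\ exists2 x, cell k x & graph T (x, xi)]
    `&` [set xi | cell m xi /\ exists2 y, cell l y & graph T (y, xi)]); last first.
    by apply/seteqP; split=> xi [] // [mxi kxi] [_ lxi].
  by apply: closedI; exact: projection_closed.
have A_le0 xi t : A xi -> A (xi + t *: delta_mx 0 i) -> t <= 0.
  move=> [mxi [x kx Tx] _] [mzeta _ [y ly Ty]]; rewrite leNgt; apply/negP => t_gt0.
  set zeta := xi + _ in mzeta Ty.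
  (* Both increments are evaluated at points of the convex set [cell m]. *)
  have increment w : exists2 eta, cell m eta &
      h (w - xi) - h (w - zeta) = t * partial i h (w - eta).
    have [s /andP[s_ge0 s_le1] sE] := mvt_direction (w - zeta) t h_drv.
    exists (xi + ((1 - s) * t) *: delta_mx 0 i).
      apply: box_segment mzeta _ => //; apply/andP; split.
        by rewrite mulr_ge0 ?subr_ge0// ltW.
      by rewrite ler_piMl ?(ltW t_gt0)// gerBl.
    have wE : w - zeta + t *: delta_mx 0 i = w - xi.
      by rewrite /zeta opprD addrA subrK.
    rewrite wE in sE; rewrite sE; congr (_ * partial i h _).
    by rewrite /zeta mulrBl mul1r scalerBl addrA !opprD opprK !addrA.
  have [eta meta xE] := increment x; have [theta mtheta yE] := increment y.
  have xi_mon : h (x - xi) - h (x - zeta) <= h (y - xi) - h (y - zeta).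
    rewrite lerBlDr addrAC lerBrDr [leRHS]addrC.
    by apply: T_mon => //; apply/set0P; [exists xi|exists zeta].
  have := sep x y eta theta kx ly meta mtheta.
  by rewrite ltNge -(ler_pM2l t_gt0) -xE -yE xi_mon.
have A_box : A `<=` cell m by move=> xi [].
apply: (lebesgue0_transversal (i := i) A_closed A_box) => xi t Axi At.
apply/eqP; rewrite eq_le (A_le0 _ _ Axi At)/= -oppr_le0.
by apply: (A_le0 _ _ At); rewrite scaleNr addrK.
Qed.

(** The values taken at two distinct points: the obstruction to the
    disjointness of the images of disjoint sets. *)
Definition overlap T : set V := [set xi | exists x y, [/\ x != y, T x xi & T y xi]].

(** The separation is an open condition on the two differences, so it spreads
    from the points to small cells around them. *)
Lemma cells_separate h i x y xi : continuous (partial i h) ->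
    partial i h (y - xi) < partial i h (x - xi) ->
  exists k l m, [/\ cell k x, cell l y, cell m xi & separates h i k l m].
Proof.
move=> Dh_cont yx; pose r := (partial i h (y - xi) + partial i h (x - xi)) / 2.
have Dsub_cont : continuous (fun z : V * V => partial i h (z.1 - z.2)).
  move=> z; apply: (@cvg_comp _ _ _ (fun z : V * V => z.1 - z.2) (partial i h)).
    exact: sub_continuous.
  exact: Dh_cont.
have [[P Q] [/= Px Qxi] PQ] : nbhs (x, xi) [set z | r < partial i h (z.1 - z.2)].
  apply: (Dsub_cont (x, xi) [set s | r < s]); apply: open_nbhs_nbhs.
  by split; [exact: open_gt|rewrite /= /r; lra].
have [[P' Q'] [/= Py Qxi'] PQ'] : nbhs (y, xi) [set z | partial i h (z.1 - z.2) < r].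
  apply: (Dsub_cont (y, xi) [set s | s < r]); apply: open_nbhs_nbhs.
  by split; [exact: open_lt|rewrite /= /r; lra].
have [k kx kP] := cell_nbhs Px; have [l ly lP] := cell_nbhs Py.
have [m mxi mQ] := cell_nbhs (filterI Qxi Qxi').
exists k, l, m; split=> // x' y' xi' zeta' /kP Px' /lP Py' /mQ[Qxi1 _] /mQ[_ Qzeta].
by apply: (@lt_trans _ _ r); [apply: (PQ' (y', zeta'))|apply: (PQ (x', xi'))].
Qed.

(** A common value [xi] of [x <> y] has [x - xi <> y - xi], hence by injectivity
    of the gradient some partial derivative of the cost tells these two points
    apart. This puts [xi] in one of countably many null sets. *)
Lemma overlap_null p h T : C2 h -> pos_homogeneous p h ->
  (forall x, unit_sphere x -> posdefmx (hessian h x)) ->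
  h_monotone h T -> closed (graph T) -> lebesgue (overlap T) = 0%E.
Proof.
move=> h_C2 h_hom h_hess T_mon T_closed.
have [_ h_C1] := h_C2.1.
pose F (q : 'I_n.+1 * (nat * 'rV[int]_n.+1) * (nat * 'rV[int]_n.+1)
    * (nat * 'rV[int]_n.+1)) : set V :=
  let: (i, k, l, m) := q in
  if `[< separates h i k l m >] then doubly_hit T k l m else set0.
have overlapF : overlap T `<=` \bigcup_q F q.
  move=> xi [x [y [xy Tx Ty]]].
  have [i] : exists i, partial i h (x - xi) != partial i h (y - xi).
    by apply: (partial_separates h_C2 h_hom h_hess); rewrite (inj_eq (addIr _)).
  rewrite neq_lt => /orP[yx|yx].
    have [k [l [m [ky lx mxi sep]]]] := cells_separate (h_C1 i).2 yx.
    exists (i, k, l, m) => //=; rewrite asboolT//.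
    by split=> //; [exists y|exists x].
  have [k [l [m [kx ly mxi sep]]]] := cells_separate (h_C1 i).2 yx.
  exists (i, k, l, m) => //=; rewrite asboolT//.
  by split=> //; [exists x|exists y].
apply: (subset_lebesgue0 overlapF).
apply: lebesgue0_bigcup => -[[[i k] l] m] /=; case: asboolP => [sep|_].
  exact: doubly_hit_null (h_C1 i).1 T_mon T_closed sep.
exact: lebesgue_set0.
Qed.

(** Up to a null set, [T] maps disjoint sets to disjoint sets and complements to
    complements in its range. Every subset of a null set is measurable, so such
    sets change neither measurability nor measure. *)
Lemma mimage_measure_space T : mleb (mimage T setT) -> lebesgue (overlap T) = 0%E ->
  measure_space [set E | lebesgue_measurable (mimage T E)]
    (fun E => lebesgue (mimage T E)).
Proof.
move=> mT overlap0; rewrite -[@lebesgue_measurable R n.+1]/mleb.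
have mimage0 : mimage T set0 = set0 by exact: bigcup_set0.
have mimage_bigcup (F : nat -> set V) :
    mimage T (\bigcup_k F k) = \bigcup_k mimage T (F k).
  apply/seteqP; split=> [xi [x [k _ Fx] Tx]|xi [k _ [x Fx Tx]]].
    by exists k => //; exists x.
  by exists x => //; exists k.
have moverlap N : N `<=` overlap T -> mleb N.
  by move=> sub; apply: lebesgue0_measurable; exact: subset_lebesgue0 overlap0.
split.
- split => [|E mE|F mF] /=.
  + by rewrite mimage0; exact: measurable0.
  + rewrite setTD (_ : mimage T (~` E) = (mimage T setT `\` mimage T E)
        `|` (mimage T (~` E) `&` mimage T E)).
      apply: measurableU; first exact: measurableD.
      apply: moverlap => xi [[x nEx Tx] [y Ey Ty]]; exists x, y; split=> //.
      by apply: contra_not_neq nEx => ->.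
    apply/seteqP; split=> [xi [x nEx Tx]|xi [[[x _ Tx] nT]|[]//]].
      have [?|?] := pselect (mimage T E xi); [right|left]; split=> //; exists x => //.
    by exists x => // Ex; apply: nT; exists x.
  + by rewrite mimage_bigcup; exact: bigcupT_measurable.
- by rewrite mimage0 lebesgue_set0.
- by move=> E _; exact: lebesgue_ge0.
- move=> F mF tF; pose G k := mimage T (F k) `\` overlap T.
  have GE k : lebesgue (G k) = lebesgue (mimage T (F k)).
    exact: lebesgue_setD_null.
  have mG k : mleb (G k).
    by apply: measurableD; [exact: mF|exact: moverlap].
  have tG : trivIset setT G.
    apply/trivIsetP => k j _ _ kj; apply/seteqP; split=> // xi.
    move=> [[[x Fx Tx] no] [[y Fy Ty] _]]; apply: no; exists x, y; split=> //.
    apply/eqP => xy; move/eqP: kj; apply; apply: (tF _ _ I I).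
    by exists x; split=> //; rewrite xy.
  rewrite mimage_bigcup -(lebesgue_setD_null _ overlap0) setD_bigcupl.
  under eq_fun do under eq_bigr do rewrite -GE.
  exact: lebesgue_sigma_additive.
Qed.

End MonotoneMaps.

Theorem theorem6 (R : realType) (n : nat) (hn : (0 < n)%N)
    (p : R) (hp : 2 <= p) (h : 'rV[R]_n -> R)
    (h_C2 : C2 h)
    (h_ge0 : forall x : 'rV[R]_n, 0 <= h x)
    (h_hom : pos_homogeneous p h)
    (h_hess : forall x : 'rV[R]_n, unit_sphere x -> posdefmx (hessian h x))
    (T : 'rV[R]_n -> set 'rV[R]_n) (T_max : maximal_h_monotone h T)
    (Z : set 'rV[R]_n) (Z_null : lebesgue Z = 0%E)
    (T_single : single_valued_on (~` Z) T) :
  measure_space [set E : set 'rV[R]_n | lebesgue_measurable (mimage T E)]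
    (fun E : set 'rV[R]_n => lebesgue (mimage T E)).
Proof.
case: n hn h h_C2 h_ge0 h_hom h_hess T T_max Z Z_null T_single => // n _.
move=> h h_C2 _ h_hom h_hess T T_max _ _ _.
have T_closed : closed (graph T) := closed_graph h_C2.1.1 T_max.
apply: mimage_measure_space; first exact: measurable_mimageT.
exact: overlap_null h_C2 h_hom h_hess T_max.1 T_closed.
Qed.
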